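(* Let $A$ be a locally skew-gentle algebra. Then $A$ is strong Koszul; that is, for its admissible presentation $KQ^{sg}/I^{sg}$, the ideal $I^{sg}$ is quadratic and has a quadratic Gröbner basis.
   Context: $K$ is an algebraically closed field with $\operatorname{char}K\neq 2$. Paths in a quiver $Q=(Q_0,Q_1,s,t)$ are written $\alpha_1\cdots\alpha_n$ with $t(\alpha_j)=s(\alpha_{j+1})$. A *locally gentle* algebra is (up to Morita equivalence) $KQ/I$ with $Q$ a finite quiver such that: every vertex has at most two incoming and at most two outgoing arrows; for each arrow $\alpha$ there is at most one arrow $\beta$ with $t(\alpha)=s(\beta)$, $\alpha\beta\in I$ and at most one $\gamma$ with $t(\gamma)=s(\alpha)$, $\gamma\alpha\in I$; for each $\alpha$ there is at most one $\beta'$ with $\alpha\beta'\notin I$ and at most one $\gamma'$ with $\gamma'\alpha\notin I$; $I$ is generated by paths of length 2. (It is gentle if moreover $I$ is admissible.) $A$ is *locally skew-gentle* if it is Morita equivalent to $K\hat Q/\hat I$ with $\hat Q_0=Q_0$, $\hat Q_1=Q_1\cup S$, $S$ a set of loops, $\hat I=\langle I\cup\{\varepsilon^2-\varepsilon:\varepsilon\in S\}\rangle$, $KQ/I$ locally gentle, and such that each vertex $i=s(\varepsilon)$, $\varepsilon\in S$ (a *special* vertex; $Sp$ is the set of these) carries only one loop from $S$, is the start or the end of exactly one arrow of $Q_1$, and if $\alpha,\beta\in Q_1$ with $t(\alpha)=i=s(\beta)$ then $\alpha\beta\in I$. **Admissible presentation.** For $i\in Q_0$ put $Q_0^{sg}(i)=\{i^+,i^-\}$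 if $i\in Sp$ and $\{i\}$ otherwise; $Q_0^{sg}=\bigcup_iQ_0^{sg}(i)$; arrows of $Q^{sg}$ are the triples $(i,\alpha,j):i\to j$ with $\alpha\in Q_1$, $i\in Q_0^{sg}(s(\alpha))$, $j\in Q_0^{sg}(t(\alpha))$; $I^{sg}$ is generated by $\sum_{j\in Q_0^{sg}(s(\beta))}\lambda_j(i,\alpha,j)(j,\beta,k)$ for paths $\alpha\beta\in I$ of length 2, $i\in Q_0^{sg}(s(\alpha))$, $k\in Q_0^{sg}(t(\beta))$, where $\lambda_j=-1$ if $j=l^-$ for some $l\in Q_0$ and $\lambda_j=1$ otherwise. **Gröbner bases.** An admissible order on the basis $\mathcal B$ of paths of a path algebra is a total order $\succ$ such that every nonempty subset has a minimal element, $p\succ q$ implies $px\succ qx$ and $wp\succ wq$ whenever these products are nonzero, and each path is $\succeq$ each of its left and right factors. $\operatorname{tip}(x)$ is the largest path occurring in $x\ne0$; $\operatorname{tip}(X)=\{\operatorname{tip}(x):x\in X\setminus\{0\}\}$. A Gröbner basis of an ideal $I$ with respect to $\succ$ is a set $\mathcal G\subset I$ of uniform elements (all paths occurring share source and share target) with $\langle\operatorname{tip}(I)\rangle=\langle\operatorname{tip}(\mathcal G)\rangle$. An algebra $KQ/I$ is *strong Koszul* if $I$ is quadratic and has a quadratic Gröbner basis (for some admissible order). *)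

(* Defs.v *)
From HB Require Import structures.
From mathcomp Require Import all_boot all_order all_algebra finmap.
From mathcomp Require Import monalg.

Set Implicit Arguments.
Unset Strict Implicit.
Unset Printing Implicit Defensive.

Import GRing.Theory.

Local Open Scope ring_scope.

(** * Quivers and paths *)

Record quiver := Quiver {
  qV : finType;
  qA : finType;
  qsrc : qA -> qV;
  qtgt : qA -> qV }.

Section Paths.
Variable Q : quiver.
Implicit Types (v : qV Q) (l : seq (qA Q)).

Fixpoint walk v l : bool :=
  if l is a :: l' then (qsrc a == v) && walk (qtgt a) l' else true.

Fixpoint walk_end v l : qV Q :=
  if l is a :: l' then walk_end (qtgt a) l' else v.

Lemma walk_cat v l1 l2 :
  walk v (l1 ++ l2) = walk v l1 && walk (walk_end v l1) l2.
Proof. by elim: l1 v => [|a l1 IH] v //=; rewrite IH andbA. Qed.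

(* A path is its source together with its arrows, read from left to right; the
   trivial path at [v] is [(v, [::])]. *)
Record qpath := QPath {
  pval : qV Q * seq (qA Q);
  pvalP : walk pval.1 pval.2 }.

HB.instance Definition _ := [isSub for pval].
HB.instance Definition _ := [Choice of qpath by <:].

Definition psrc (p : qpath) : qV Q := (pval p).1.
Definition parr (p : qpath) : seq (qA Q) := (pval p).2.
Definition ptgt (p : qpath) : qV Q := walk_end (psrc p) (parr p).
Definition plen (p : qpath) : nat := size (parr p).

Definition ptriv v : qpath := @QPath (v, [::]) isT.

Fact walk_arrow (a : qA Q) : walk (qsrc a) [:: a].
Proof. by rewrite /= eqxx. Qed.
Definition parrow (a : qA Q) : qpath := @QPath (qsrc a, [:: a]) (walk_arrow a).

(* [None] stands for the product 0 of two non-composable paths, and occurs only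
   for those: see [isSome_pcat]. *)
Definition pcat (p q : qpath) : option qpath :=
  if ptgt p == psrc q then insub (psrc p, parr p ++ parr q) else None.

Lemma isSome_pcat p q : isSome (pcat p q) = (ptgt p == psrc q).
Proof.
rewrite /pcat; case: eqP => // e; rewrite insubT //= walk_cat.
by rewrite (pvalP p) /= -/(ptgt p) e (pvalP q).
Qed.

End Paths.

(** * Path algebras and their ideals *)

Notation palg K Q := {malg K[qpath Q]}.

Section PathAlgebra.
Variables (K : fieldType) (Q : quiver).
Implicit Types (x y z : palg K Q) (X I J : palg K Q -> Prop).

Definition path_mul (p q : qpath Q) : palg K Q :=
  if pcat p q is Some r then << r >> else 0.

Definition pmul x y : palg K Q :=
  \sum_(p <- msupp x) \sum_(q <- msupp y) (x@_p * y@_q) *: path_mul p q.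

Definition pone : palg K Q := \sum_(v : qV Q) << ptriv v >>.

Definition arrow (a : qA Q) : palg K Q := << parrow a >>.

(* [K]-subspaces are recovered from closure under multiplication by [c *: pone],
   as the path algebra of a finite quiver is unital. *)
Inductive ideal_gen X : palg K Q -> Prop :=
| ideal_gen0 : ideal_gen X 0
| ideal_gen_in x : X x -> ideal_gen X x
| ideal_genD x y : ideal_gen X x -> ideal_gen X y -> ideal_gen X (x + y)
| ideal_genMl x y : ideal_gen X y -> ideal_gen X (pmul x y)
| ideal_genMr x y : ideal_gen X x -> ideal_gen X (pmul x y).

Definition same_set X J : Prop := forall x, X x <-> J x.

Definition paths_in (P : qpath Q -> Prop) x : Prop :=
  exists2 p, P p & x = << p >>.

Definition quadratic_elt x : Prop := forall p, p \in msupp x -> plen p = 2%N.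

Definition quadratic_ideal I : Prop :=
  exists2 X, (forall x, X x -> quadratic_elt x) & same_set I (ideal_gen X).

(** * Gröbner bases *)

Definition plt (le : rel (qpath Q)) : rel (qpath Q) :=
  fun p q => (p != q) && le p q.

Record admissible_order (le : rel (qpath Q)) : Prop := AdmissibleOrder {
  ao_refl : reflexive le;
  ao_anti : antisymmetric le;
  ao_trans : transitive le;
  ao_total : total le;
  ao_wf : forall P : qpath Q -> Prop, (exists p, P p) ->
    exists2 p, P p & forall q, P q -> le p q;
  ao_mulr : forall p q u pu qu : qpath Q, plt le q p ->
    pcat p u = Some pu -> pcat q u = Some qu -> plt le qu pu;
  ao_mull : forall p q w wp wq : qpath Q, plt le q p ->
    pcat w p = Some wp -> pcat w q = Some wq -> plt le wq wp;
  ao_factor : forall p q r, pcat q r = Some p -> le q p /\ le r p }.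

Definition is_tip (le : rel (qpath Q)) x (p : qpath Q) : Prop :=
  p \in msupp x /\ forall q, q \in msupp x -> le q p.

Definition tips (le : rel (qpath Q)) X (p : qpath Q) : Prop :=
  exists x, [/\ X x, x != 0 & is_tip le x p].

Definition uniform x : Prop := forall p q, p \in msupp x -> q \in msupp x ->
  psrc p = psrc q /\ ptgt p = ptgt q.

Record groebner_basis (le : rel (qpath Q)) I (G : palg K Q -> Prop) : Prop :=
  GroebnerBasis {
    gb_sub : forall g, G g -> I g;
    gb_uniform : forall g, G g -> uniform g;
    gb_tip : same_set (ideal_gen (paths_in (tips le I)))
                      (ideal_gen (paths_in (tips le G))) }.

Definition strong_koszul I : Prop :=
  quadratic_ideal I /\
  exists le, admissible_order le /\
    exists2 G, groebner_basis le I G & forall g, G g -> quadratic_elt g.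

(** * Locally gentle algebras *)

Definition path2_in I (a b : qA Q) : Prop :=
  qtgt a = qsrc b /\ I (pmul (arrow a) (arrow b)).

Definition path2_notin I (a b : qA Q) : Prop :=
  qtgt a = qsrc b /\ ~ I (pmul (arrow a) (arrow b)).

Record locally_gentle I : Prop := LocallyGentle {
  lg_in : forall v : qV Q, (#|[set a : qA Q | qtgt a == v]| <= 2)%N;
  lg_out : forall v : qV Q, (#|[set a : qA Q | qsrc a == v]| <= 2)%N;
  lg_rel_right : forall a b b', path2_in I a b -> path2_in I a b' -> b = b';
  lg_rel_left : forall a c c', path2_in I c a -> path2_in I c' a -> c = c';
  lg_nrel_right :
    forall a b b', path2_notin I a b -> path2_notin I a b' -> b = b';
  lg_nrel_left :
    forall a c c', path2_notin I c a -> path2_notin I c' a -> c = c';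
  lg_gen : exists2 P : qpath Q -> Prop, (forall p, P p -> plen p = 2%N) &
    same_set I (ideal_gen (paths_in P)) }.

End PathAlgebra.

(** * Algebras over a field, quotients of path algebras, Morita equivalence *)

(* Unlike [algType K], this includes the zero algebra, which is the path algebra
   of the empty quiver. *)
Record kalgebra (K : fieldType) := KAlgebra {
  kring :> pzRingType;
  kemb : {rmorphism K -> kring};
  kembC : forall c (a : kring), kemb c * a = a * kemb c }.

Definition is_path_quotient (K : fieldType) (B : kalgebra K) (Q : quiver)
    (J : palg K Q -> Prop) : Prop :=
  exists f : {additive palg K Q -> B},
    [/\ forall c x, f (c *: x) = kemb B c * f x,
        forall x y, f (pmul x y) = f x * f y,
        f (pone K Q) = 1,
        forall b, exists x, f x = b &
        forall x, f x = 0 <-> J x].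

(* A [K]-linear functor between categories of left modules; the axioms range
   over all [h] that agree pointwise with an identity, a composite or a linear
   combination, which makes [fmor] compatible with pointwise equality. *)
Record mod_functor (K : fieldType) (A B : kalgebra K) := ModFunctor {
  fobj : lmodType A -> lmodType B;
  fmor : forall M N : lmodType A,
    {linear M -> N} -> {linear fobj M -> fobj N};
  fmor_id : forall (M : lmodType A) (h : {linear M -> M}),
    h =1 id -> fmor h =1 id;
  fmor_comp : forall (M N P : lmodType A)
      (f : {linear M -> N}) (g : {linear N -> P}) (h : {linear M -> P}),
    h =1 g \o f -> fmor h =1 fmor g \o fmor f;
  fmor_lin : forall (M N : lmodType A) (c : K) (f g h : {linear M -> N}),
    h =1 (fun x => kemb A c *: f x + g x) ->
    fmor h =1 (fun x => kemb B c *: fmor f x + fmor g x) }.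

Definition morita_equivalent (K : fieldType) (A B : kalgebra K) : Prop :=
  exists F : mod_functor A B,
    [/\ forall (M N : lmodType A) (f g : {linear M -> N}),
          fmor F f =1 fmor F g -> f =1 g,
        forall (M N : lmodType A) (g : {linear fobj F M -> fobj F N}),
          exists f : {linear M -> N}, fmor F f =1 g &
        forall N : lmodType B,
          exists (M : lmodType A) (h : {linear fobj F M -> N}), bijective h].

(** * Locally skew-gentle algebras *)

(* The set of special loops is a finite type [S], with [b e] the vertex carrying
   the loop [e]. *)
Section SkewGentle.
Variables (K : fieldType) (Q : quiver) (S : finType).
Variables (I : palg K Q -> Prop) (b : S -> qV Q).

Definition special : {set qV Q} := [set b e | e : S].

Record skew_gentle_data : Prop := SkewGentleData {
  sgd_gentle : locally_gentle I;
  sgd_loop : injective b;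
  sgd_one : forall i, i \in special ->
    #|[set a : qA Q | qsrc a == i]| = 1%N \/
    #|[set a : qA Q | qtgt a == i]| = 1%N;
  sgd_rel : forall a c : qA Q, qtgt a \in special -> qtgt a = qsrc c ->
    I (pmul (arrow K a) (arrow K c)) }.

Definition hat_quiver : quiver := {|
  qV := qV Q;
  qA := (qA Q + S)%type;
  qsrc := fun x => match x with inl a => qsrc a | inr e => b e end;
  qtgt := fun x => match x with inl a => qtgt a | inr e => b e end |}.

Fact hat_walk (v : qV Q) (l : seq (qA Q)) :
  walk v l -> @walk hat_quiver v (map inl l).
Proof. by elim: l v => //= a l IH v /andP[-> /IH]. Qed.

Definition hat_path (p : qpath Q) : qpath hat_quiver :=
  @QPath hat_quiver (psrc p, map inl (parr p)) (hat_walk (pvalP p)).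

Definition hat_incl (x : palg K Q) : palg K hat_quiver :=
  \sum_(p <- msupp x) x@_p *: << hat_path p >>.

Definition loop (e : S) : palg K hat_quiver := @arrow K hat_quiver (inr e).

Definition hat_ideal : palg K hat_quiver -> Prop :=
  ideal_gen (fun z => (exists2 x, I x & z = hat_incl x) \/
                      (exists e, z = pmul (loop e) (loop e) - loop e)).

Definition is_locally_skew_gentle (A : kalgebra K) : Prop :=
  skew_gentle_data /\
  exists2 B : kalgebra K, is_path_quotient B hat_ideal & morita_equivalent A B.

(** * The admissible presentation *)

(* [(i, None)] is a non-special vertex [i]; for [i] special, [(i, Some true)] is
   [i^+] and [(i, Some false)] is [i^-]. *)
Definition sg_vertex : finType :=
  {x : qV Q * option bool | isSome x.2 == (x.1 \in special)}.

Definition sg_base (i : sg_vertex) : qV Q := (val i).1.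

Definition sg_arrow : finType :=
  {x : sg_vertex * qA Q * sg_vertex |
    (sg_base x.1.1 == qsrc x.1.2) && (sg_base x.2 == qtgt x.1.2)}.

Definition sg_quiver : quiver := {|
  qV := sg_vertex;
  qA := sg_arrow;
  qsrc := fun x => (val x).1.1;
  qtgt := fun x => (val x).2 |}.

(* The arrow [(i, a, j)]; the default 0 is returned only when [i] does not lie
   over the source of [a] or [j] not over its target. *)
Definition sg_arr (i : sg_vertex) (a : qA Q) (j : sg_vertex) :
    palg K sg_quiver :=
  if insub (i, a, j) is Some x then @arrow K sg_quiver x else 0.

Definition sg_sign (j : sg_vertex) : K :=
  if (val j).2 == Some false then -1 else 1.

Definition sg_relation (i : sg_vertex) (a c : qA Q) (k : sg_vertex) :
    palg K sg_quiver :=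
  \sum_(j : sg_vertex | sg_base j == qsrc c)
    sg_sign j *: pmul (sg_arr i a j) (sg_arr j c k).

Definition sg_ideal : palg K sg_quiver -> Prop :=
  ideal_gen (fun z => exists i a c k,
    [/\ path2_in I a c, sg_base i = qsrc a, sg_base k = qtgt c &
        z = sg_relation i a c k]).

End SkewGentle.

Arguments hat_ideal {K Q S} I b _.
Arguments is_locally_skew_gentle {K Q S} I b A.
Arguments sg_ideal {K Q S} I b _.

(* Main.v *)
(** The relations of the admissible presentation form a quadratic Groebner
    basis, and for this only the shape of these relations matters.  Order the
    arrows so that replacing a vertex [i^+] by [i^-] at either end of an arrow
    lowers it, and extend this to paths by length and then lexicographically; the
    tip of a relation is then its path through [i^+], or its only path when the
    middle vertex is not special.  Send a path to 0 if it passes through a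
    non-special vertex between two arrows [a], [c] with [a c] in [I], and
    otherwise replace each [i^+] lying between two such arrows by [i^-].  This
    normal form is compatible with products and kills the relations, hence its
    linear extension kills the ideal.  A path equal to its own normal form is
    strictly smaller than all other paths with that normal form, so it cannot be
    the tip of an element of the ideal; and a path that is not its own normal
    form has the tip of a relation as a factor. *)

From HB Require Import structures.
Require Import Defs.
From mathcomp Require Import all_boot all_order all_algebra finmap.
From mathcomp Require Import monalg.
From mathcomp Require Import boolp.
From mathcomp Require Import zify ring.

Set Implicit Arguments.
Unset Strict Implicit.
Unset Printing Implicit Defensive.

Import GRing.Theory.

Local Open Scope ring_scope.

(** * Linear maps given by their values on a basis *)

Section LinearExtension.
Variables (K : fieldType) (T : choiceType) (V : lmodType K).
Implicit Types (f : T -> V) (x y : {malg K[T]}).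

Definition lext f x : V := \sum_(p <- msupp x) x@_p *: f p.

(** Coefficients vanish off the support, so elements with different supports can be summed over one
    common set [d]. *)
Lemma lextEw (d : {fset T}) f x :
  (msupp x `<=` d)%fset -> lext f x = \sum_(p <- d) x@_p *: f p.
Proof.
move=> le_xd; apply: big_fset_incl => // p _ /mcoeff_outdom ->.
by rewrite scale0r.
Qed.

Lemma lext_is_linear f : linear (lext f).
Proof.
move=> c x y; have le_d : (msupp (c *: x + y) `<=` msupp x `|` msupp y)%fset.
  apply: fsubset_trans (msuppD_le _ _) _.
  by apply: fsetUSS; [exact: msuppZ_le | exact: fsubset_refl].
rewrite (lextEw _ le_d) (lextEw _ (fsubsetUl _ (msupp y))).
rewrite (lextEw _ (fsubsetUr (msupp x) _)) scaler_sumr -big_split /=.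
by apply: eq_bigr => p _; rewrite mcoeffD mcoeffZ scalerDl scalerA.
Qed.

HB.instance Definition _ f :=
  GRing.isLinear.Build K {malg K[T]} V *:%R (lext f) (lext_is_linear f).

Lemma lextU f p : lext f << p >> = f p.
Proof.
by rewrite (lextEw _ msuppU_le) big_seq_fset1 mcoeffUU scale1r.
Qed.

Lemma lextZU f c p : lext f (c *: << p >>) = c *: f p.
Proof. by rewrite linearZ /= lextU. Qed.

Lemma eq_lext f g x : f =1 g -> lext f x = lext g x.
Proof. by move=> eq_fg; apply: eq_bigr => p _; rewrite eq_fg. Qed.

End LinearExtension.

Lemma lext_lext (K : fieldType) (T U : choiceType) (V : lmodType K)
    (f : U -> V) (g : T -> {malg K[U]}) (x : {malg K[T]}) :
  lext f (lext g x) = lext (lext f \o g) x.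
Proof.
by rewrite linear_sum; apply: eq_bigr => p _; rewrite linearZ.
Qed.

Lemma lext_exchange (K : fieldType) (T U : choiceType) (V : lmodType K)
    (F : T -> U -> V) (x : {malg K[T]}) (y : {malg K[U]}) :
  lext (fun p => lext (F p) y) x = lext (fun q => lext (F^~ q) x) y.
Proof.
transitivity
    (\sum_(p <- msupp x) \sum_(q <- msupp y) (x@_p * y@_q) *: F p q).
  apply: eq_bigr => p _; rewrite scaler_sumr.
  by apply: eq_bigr => q _; rewrite scalerA.
rewrite exchange_big; apply: eq_bigr => q _; rewrite scaler_sumr.
by apply: eq_bigr => p _; rewrite scalerA mulrC.
Qed.

(** * Products of paths and membership in ideals *)

Section PathProducts.
Variables (K : fieldType) (Q : quiver).
Implicit Types (p q : qpath Q) (x y : palg K Q) (X Y : palg K Q -> Prop).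

Lemma pmulE x y : pmul x y = lext (fun p => lext (path_mul K p) y) x.
Proof.
apply: eq_bigr => p _; rewrite scaler_sumr.
by apply: eq_bigr => q _; rewrite scalerA.
Qed.

Lemma pmulUU p q : pmul << p >> << q >> = path_mul K p q.
Proof. by rewrite pmulE !lextU. Qed.

Lemma pmul0x x : pmul 0 x = 0.
Proof. by rewrite pmulE linear0. Qed.

Lemma pmulx0 x : pmul x 0 = 0.
Proof. by rewrite /pmul big1 // => p _; rewrite msupp0 big_seq_fset0. Qed.

Lemma qpath_eqP p q : psrc p = psrc q -> parr p = parr q -> p = q.
Proof.
case: p q => [[v l] vl] [[w m] wm]; rewrite /psrc /parr /= => e1 e2.
by apply: val_inj; rewrite /= e1 e2.
Qed.

(** The product is recorded by its source and arrows, which determine it by [qpath_eqP]. *)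
Variant pcat_spec p q : option (qpath Q) -> Type :=
| PcatSome r of ptgt p = psrc q & psrc r = psrc p & parr r = parr p ++ parr q :
    pcat_spec p q (Some r)
| PcatNone of ptgt p <> psrc q : pcat_spec p q None.

Lemma pcatP p q : pcat_spec p q (pcat p q).
Proof.
have := isSome_pcat p q; rewrite /pcat; case: eqP => [e | ne _];
  last exact: PcatNone.
by case: insubP => // r _ er _; apply: PcatSome => //; rewrite /psrc /parr er.
Qed.

Lemma path_mul_cat p q s : psrc s = psrc p -> ptgt p = psrc q ->
  parr s = parr p ++ parr q -> path_mul K p q = << s >>.
Proof.
rewrite /path_mul => es e earr; case: pcatP => [s' _ es' earr' | //].
by congr << _ >>; apply: qpath_eqP; rewrite ?es ?es' ?earr ?earr'.
Qed.

(** Cutting [p] at both ends of [t] gives paths [p1] and [p2] with [p = p1 (t p2)]. *)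
Lemma ideal_gen_factor X p t l1 l2 :
    parr p = l1 ++ parr t ++ l2 -> walk_end (psrc p) l1 = psrc t ->
  ideal_gen X << t >> -> ideal_gen X << p >>.
Proof.
move=> ep et Xt; have := pvalP p; rewrite -/(parr p) -/(psrc p) ep !walk_cat et.
move=> /andP[w1 /andP[wt w2]].
have ws : walk (psrc t) (parr t ++ l2) by rewrite walk_cat wt.
pose p1 := @QPath Q (psrc p, l1) w1; pose s := @QPath Q (psrc t, _ ++ _) ws.
pose p2 := @QPath Q (walk_end (psrc t) (parr t), l2) w2.
have <- : path_mul K p1 s = << p >> by apply: path_mul_cat.
rewrite -pmulUU; apply: ideal_genMl.
have <- : path_mul K t p2 = << s >> by apply: path_mul_cat.
by rewrite -pmulUU; apply: ideal_genMr.
Qed.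

Lemma ideal_gen_sub X Y : (forall x, X x -> ideal_gen Y x) ->
  forall x, ideal_gen X x -> ideal_gen Y x.
Proof.
move=> XY x; elim=> [|y /XY //|y z _ Yy _ Yz|y z _|y z _].
- exact: ideal_gen0.
- exact: ideal_genD.
- exact: ideal_genMl.
- exact: ideal_genMr.
Qed.

End PathProducts.

(** * The length-lexicographic order on paths *)

(* A path is read as a number in base [base], whose leading digit is its source
   and whose next digits are its arrows.  The leading digit is shifted by one so
   as to be nonzero, which makes longer paths larger. *)
Section CodeOrder.
Variables (Q : quiver) (code : qA Q -> nat).
Hypothesis code_inj : injective code.
Local Open Scope nat_scope.
Implicit Types (p q u w : qpath Q) (l : seq (qA Q)).

(** The summand [#|qV Q|] makes [base] exceed the leading digits as well as the codes of arrows. *)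
Let base := (\max_a code a + #|qV Q|).+1.

Definition digits n l := foldl (fun m a => m * base + code a) n l.

Definition path_code p := digits (enum_rank (psrc p)).+1 (parr p).

Definition code_le : rel (qpath Q) := fun p q => path_code p <= path_code q.

Lemma code_lt_base a : code a < base.
Proof. by rewrite ltnS; apply: leq_trans (leq_addr _ _); apply: leq_bigmax. Qed.

Lemma digitsE n l : digits n l = n * base ^ size l + digits 0 l.
Proof.
elim: l n => [|a l IH] n /=; first by rewrite muln1 addn0.
by rewrite IH [digits (0 * _ + _) _]IH expnS; ring.
Qed.

Lemma digits_lt l : digits 0 l < base ^ size l.
Proof.
elim: l => [//|a l IH] /=; rewrite digitsE mul0n add0n expnS.
have := code_lt_base a; move: IH; set D := digits 0 l; set C := base ^ _.
nia.
Qed.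

Lemma digits_cat n l1 l2 :
  digits n (l1 ++ l2) = digits n l1 * base ^ size l2 + digits 0 l2.
Proof. by rewrite /digits foldl_cat -/(digits _ _) -/(digits _ _) digitsE. Qed.

(** The last digit is the remainder modulo [base], the rest the quotient. If one list runs out
    first, a number below [base] would equal one that is at least [base], its leading digit being
    nonzero. *)
Lemma digits_inj n n' l l' : 0 < n < base -> 0 < n' < base ->
  digits n l = digits n' l' -> n = n' /\ l = l'.
Proof.
move=> /andP[n_gt0 n_lt] /andP[n'_gt0 n'_lt].
have pos m s : 0 < m -> 0 < digits m s.
  by move=> m_gt0; rewrite digitsE addn_gt0 muln_gt0 m_gt0 expn_gt0.
elim/last_ind: l l' => [|l a IH] l'; case/lastP: l' => [|l' a'].
- by [].
- rewrite /digits foldl_rcons /= -/(digits _ _) => e.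
  by have := pos _ l' n'_gt0; nia.
- rewrite /digits foldl_rcons /= -/(digits _ _) => e.
  by have := pos _ l n_gt0; nia.
rewrite /digits !foldl_rcons -!/(digits _ _) => e.
have ea : code a = code a'.
  move/(congr1 (modn^~ base)): e.
  by rewrite !modnMDl !modn_small ?code_lt_base.
have [|-> ->] := IH l'; last by rewrite (code_inj ea).
move/(congr1 (divn^~ base)): e.
by rewrite !divnMDl // !divn_small ?code_lt_base // !addn0.
Qed.

Lemma lead_bounds (v : qV Q) : 0 < (enum_rank v).+1 < base.
Proof. by rewrite ltnS; apply: leq_trans (ltn_ord _) (leq_addl _ _). Qed.

Lemma path_code_inj : injective path_code.
Proof.
move=> p q e; have [[er] el] := digits_inj (lead_bounds _) (lead_bounds _) e.
by apply: qpath_eqP => //; apply: enum_rank_inj; apply: val_inj.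
Qed.

Lemma plt_code p q : plt code_le p q = (path_code p < path_code q).
Proof. by rewrite /plt /code_le ltn_neqAle (inj_eq path_code_inj). Qed.

(** A path of length [n] has its code between [base ^ n] and [base ^ n.+1], the upper bound being
    strict. *)
Lemma path_code_ltn p q : plen p < plen q -> path_code p < path_code q.
Proof.
move=> lt_pq; rewrite /path_code ![digits _.+1 _]digitsE.
have := digits_lt (parr p); have /andP[_] := lead_bounds (psrc p).
have : base ^ (plen p).+1 <= base ^ plen q by rewrite leq_pexp2l.
rewrite expnS /plen; set N := _.+1; set M := _.+1.
nia.
Qed.

Lemma code_admissible : admissible_order code_le.
Proof.
split.
- by move=> p; apply: leqnn.
- by move=> p q /anti_leq/path_code_inj.
- by move=> q p r; apply: leq_trans.
- by move=> p q; apply: leq_total.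
- move=> P [p Pp].
  have ex_n : exists n, `[< exists2 q, P q & path_code q = n >].
    by exists (path_code p); apply/asboolP; exists p.
  case: (ex_minnP ex_n) => n /asboolP[q Pq <-] min_q; exists q => // s Ps.
  by apply: min_q; apply/asboolP; exists s.
- move=> p q u pu qu; rewrite !plt_code => lt_qp.
  case: pcatP => // s _ es ea [<-]; case: pcatP => // s' _ es' ea' [<-].
  (* Right multiplication by [u] multiplies both codes by the same power of [base] and adds the same
     number. *)
  rewrite /path_code es ea es' ea' !digits_cat ltn_add2r ltn_pmul2r //.
  by rewrite expn_gt0.
- move=> p q w wp wq; rewrite !plt_code => lt_qp.
  case: pcatP => // s ep es ea [<-]; case: pcatP => // s' eq es' ea' [<-].
  have [lt_len|le_len] := ltnP (plen q) (plen p).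
    by apply: path_code_ltn; rewrite /plen ea ea' !size_cat ltn_add2l.
  have eq_len : plen p = plen q.
    apply/eqP; rewrite eqn_leq le_len leqNgt; apply/negP => /path_code_ltn.
    by rewrite ltnNge (ltnW lt_qp).
  rewrite /path_code es es' ea ea' !digits_cat -!/(plen _) eq_len ltn_add2l.
  (* Both [p] and [q] start where [w] ends, so their leading digits agree and the arrows alone
     decide. *)
  move: lt_qp; rewrite /path_code -ep -eq ![digits _.+1 (parr _)]digitsE.
  by rewrite -!/(plen _) eq_len ltn_add2l.
- move=> p q r; case: pcatP => // s e es ea [<-]; split.
    have [r0|r_gt0] := posnP (plen r).
      suff -> : q = s by exact: leqnn.
      by apply: qpath_eqP; rewrite ?es ?ea // (size0nil r0) cats0.
    by apply/ltnW/path_code_ltn; rewrite /plen ea size_cat -ltn_subLR // subnn.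
  have [q0|q_gt0] := posnP (plen q).
    suff -> : r = s by exact: leqnn.
    apply: qpath_eqP; rewrite ?es ?ea ?(size0nil q0) //.
    by rewrite -e /ptgt (size0nil q0).
  apply/ltnW/path_code_ltn; rewrite /plen ea size_cat.
  by rewrite -[X in X < _]add0n ltn_add2r.
Qed.

Lemma digits_le n l l' :
  all2 (fun a a' => code a <= code a') l l' -> digits n l <= digits n l'.
Proof.
elim: l l' n => [|a l IH] [|a' l'] // n /= /andP[le_a le_l].
apply: leq_trans (IH _ _ le_l) _.
by rewrite digitsE [leqRHS]digitsE leq_add2r leq_mul2r leq_add2l le_a orbT.
Qed.

End CodeOrder.

(** * Lowering vertices and arrows *)

Section Lowering.
Variables (Q : quiver) (S : finType) (b : S -> qV Q) (r : rel (qA Q)).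
Local Notation sgQ := (sg_quiver b).
Local Notation sgV := (sg_vertex b).
Local Notation sgA := (sg_arrow b).
Implicit Types (v : sgV) (x y : sgA) (l : seq sgA) (c d : bool).
Implicit Types (p q : qpath sgQ).

Definition mid x : qA Q := (val x).1.2.

(** This sends [i^+] to [i^-] and fixes every other vertex; the default of [insubd] is never
    reached, by [val_lower]. *)
Definition lower v : sgV :=
  insubd v ((val v).1, omap (fun=> false) (val v).2).

Lemma val_lower v : val (lower v) = ((val v).1, omap (fun=> false) (val v).2).
Proof.
rewrite val_insubd; case: ifP => // /negP[] /=.
by rewrite -(eqP (valP v)); case: (val v).2.
Qed.

Lemma sg_base_lower v : sg_base (lower v) = sg_base v.
Proof. by rewrite /sg_base val_lower. Qed.

Lemma lower_id v : (val v).2 != Some true -> lower v = v.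
Proof.
move=> nv; apply: val_inj; rewrite val_lower.
by case: (val v) nv => [i [[]|]].
Qed.

Lemma lowerK v : lower (lower v) = lower v.
Proof. by apply: lower_id; rewrite val_lower /=; case: (val v).2. Qed.

Definition lower_if c v := if c then lower v else v.

Lemma lower_if2 c d v : lower_if c (lower_if d v) = lower_if (c || d) v.
Proof. by case: c d => [] []; rewrite /= ?lowerK. Qed.

Lemma sg_base_lower_if c v : sg_base (lower_if c v) = sg_base v.
Proof. by case: c; rewrite /= ?sg_base_lower. Qed.

Lemma base_src x : sg_base (@qsrc sgQ x) = qsrc (mid x).
Proof. by have /andP[/eqP] := valP x. Qed.

Lemma base_tgt x : sg_base (@qtgt sgQ x) = qtgt (mid x).
Proof. by have /andP[_ /eqP] := valP x. Qed.

Definition alow c d x : sgA :=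
  insubd x (lower_if c (@qsrc sgQ x), mid x, lower_if d (@qtgt sgQ x)).

Lemma val_alow c d x :
  val (alow c d x) =
    (lower_if c (@qsrc sgQ x), mid x, lower_if d (@qtgt sgQ x)).
Proof.
rewrite val_insubd; case: ifP => // /negP[] /=.
by rewrite !sg_base_lower_if base_src base_tgt !eqxx.
Qed.

Lemma src_alow c d x : @qsrc sgQ (alow c d x) = lower_if c (@qsrc sgQ x).
Proof. by rewrite /= val_alow. Qed.

Lemma tgt_alow c d x : @qtgt sgQ (alow c d x) = lower_if d (@qtgt sgQ x).
Proof. by rewrite /= val_alow. Qed.

Lemma mid_alow c d x : mid (alow c d x) = mid x.
Proof. by rewrite /mid val_alow. Qed.

Lemma sg_arrow_eqP x y : @qsrc sgQ x = @qsrc sgQ y -> mid x = mid y ->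
  @qtgt sgQ x = @qtgt sgQ y -> x = y.
Proof.
have eq3 (u w : sgV * qA Q * sgV) :
    u.1.1 = w.1.1 -> u.1.2 = w.1.2 -> u.2 = w.2 -> u = w.
  by case: u w => [[? ?] ?] [[? ?] ?] /= -> -> ->.
by move=> es em et; apply/val_inj/eq3.
Qed.

Lemma alow2 c d c' d' x :
  alow c d (alow c' d' x) = alow (c || c') (d || d') x.
Proof.
by apply: sg_arrow_eqP; rewrite ?mid_alow ?src_alow ?tgt_alow ?lower_if2.
Qed.

(** * Lowering walks *)

Definition rflag x l d := if l is y :: _ then r (mid x) (mid y) else d.

(* [c] and [d] tell whether the two endpoints of the walk are lowered too. *)
Fixpoint alows c d l : seq sgA :=
  if l is x :: l' then
    let e := rflag x l' d in alow c e x :: alows e d l'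
  else [::].

Lemma map_mid_alows c d l : map mid (alows c d l) = map mid l.
Proof. by elim: l c => //= x l IH c; rewrite mid_alow IH. Qed.

(** Whether an interior vertex is lowered depends only on the underlying arrows at its two sides,
    which lowering preserves. *)
Lemma rflag_mid x y l l' d : mid x = mid y -> map mid l = map mid l' ->
  rflag x l d = rflag y l' d.
Proof. by case: l l' => [|z l] [|z' l'] //= -> [-> _]. Qed.

(** Both passes lower the same interior vertices, so only the flags at the two ends accumulate. *)
Lemma alows2 c d c' d' l :
  alows c d (alows c' d' l) = alows (c || c') (d || d') l.
Proof.
elim: l c c' => //= x l IH c c'; set e := rflag (alow _ _ _) _ d.
have e_def: e = rflag x l d.
  by apply: rflag_mid; rewrite ?mid_alow ?map_mid_alows.
have -> : rflag x l (d || d') = e || rflag x l d'.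
  by rewrite e_def; case: l {IH e e_def} => //= y l; rewrite orbb.
by rewrite alow2 IH.
Qed.

Lemma alows_cat c d x l1 l2 : let e := rflag (last x l1) l2 d in
  alows c d (x :: l1 ++ l2) = alows c e (x :: l1) ++ alows e d l2.
Proof. by elim: l1 c x => [|y l1 IH] c x //=; congr cons; apply: IH. Qed.

(** The inner pass spares the ends of [l2], and the flag at the junction is the same before and
    after it. This makes normal forms compatible with products. *)
Lemma alows_catr l1 l2 :
  alows false false (l1 ++ alows false false l2) = alows false false (l1 ++ l2).
Proof.
case: l1 => [|x l1]; first by rewrite /= alows2.
rewrite !alows_cat alows2 orbF.
have -> : rflag (last x l1) (alows false false l2) false
         = rflag (last x l1) l2 false.
  by apply: rflag_mid; rewrite ?map_mid_alows.
by [].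
Qed.

Lemma alows_catl l1 l2 :
  alows false false (alows false false l1 ++ l2) = alows false false (l1 ++ l2).
Proof.
case: l1 => // x l1; have low2 d :
    alows false d (alows false false (x :: l1)) = alows false d (x :: l1).
  by rewrite alows2 !orbF.
move: low2; have := map_mid_alows false false (x :: l1).
case: (alows false false (x :: l1)) => // y m [eqmid eqmids] low2.
rewrite !alows_cat; set e := rflag _ _ _.
have -> : e = rflag (last x l1) l2 false.
  by apply: rflag_mid; rewrite // -last_map eqmid eqmids last_map.
by rewrite low2.
Qed.

(** Consecutive arrows receive the same flag at their common vertex, so they stay composable. *)
Lemma walk_alows c d v l :
  walk (Q := sgQ) v l -> walk (Q := sgQ) (lower_if c v) (alows c d l).
Proof.
elim: l c v => //= x l IH c v /andP[/eqP <- /IH].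
by rewrite val_alow /= eqxx; apply.
Qed.

Lemma walk_end_alows v l :
  walk_end (Q := sgQ) v (alows false false l) = walk_end (Q := sgQ) v l.
Proof.
(* The end of a nonempty walk does not depend on its start, which the induction on the tail may
   lower. *)
case: l => // x l; suff gen c : walk_end (Q := sgQ) v (alows c false (x :: l))
  = walk_end (Q := sgQ) v (x :: l) by exact: gen.
elim: l x v c => [|y l IH] x v c; first by rewrite /= val_alow.
exact: IH.
Qed.

(** * Normal forms of paths *)

Definition nf p : qpath sgQ :=
  @QPath sgQ (psrc p, alows false false (parr p))
    (walk_alows false false (pvalP p)).

Lemma psrc_nf p : psrc (nf p) = psrc p. Proof. by []. Qed.

Lemma parr_nf p : parr (nf p) = alows false false (parr p). Proof. by []. Qed.

Lemma ptgt_nf p : ptgt (nf p) = ptgt p.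
Proof. exact: walk_end_alows. Qed.

(** The paths that fail this test are those sent to 0. *)
Definition alive l :=
  sorted (fun a a1 => r a a1 ==> (qtgt a \in special b)) (map mid l).

Lemma alive_catl l1 l2 : alive (l1 ++ l2) -> alive l1.
Proof. by rewrite /alive map_cat => /cat_sorted2[]. Qed.

Lemma alive_catr l1 l2 : alive (l1 ++ l2) -> alive l2.
Proof. by rewrite /alive map_cat => /cat_sorted2[]. Qed.

Lemma alive_alows l : alive (alows false false l) = alive l.
Proof. by rewrite /alive map_mid_alows. Qed.

(** Asking for [Some false] excludes both [i^+] and non-special vertices between related arrows, so
    a normal path is alive and fixed by [nf]. *)
Definition normal l :=
  sorted (fun x y => r (mid x) (mid y) ==>
                     ((val (@qtgt sgQ x)).2 == Some false)) l.

Lemma sg_base_special v : isSome (val v).2 = (sg_base v \in special b).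
Proof. exact: eqP (valP v). Qed.

Lemma normal_alive l : normal l -> alive l.
Proof.
rewrite /alive sorted_map; apply: sub_sorted => x y /= /implyP nxy.
by apply/implyP => /nxy/eqP tx; rewrite -base_tgt -sg_base_special tx.
Qed.

Lemma normal_alows v l :
  walk (Q := sgQ) v l -> normal l -> alows false false l = l.
Proof.
(* In the induction the start may be lowered, provided that this leaves it unchanged. *)
suff gen c : (c -> lower v = v) -> walk (Q := sgQ) v l -> normal l ->
  alows c false l = l by exact: gen.
elim: l c v => //= x l IH c v low_v /andP[/eqP src_x wl] nl.
have tgt_x : rflag x l false -> lower (@qtgt sgQ x) = @qtgt sgQ x.
  case: l nl {IH wl} => //= y l /andP[/implyP nxy _] /nxy/eqP tx.
  by apply: lower_id; rewrite tx.
rewrite (IH _ (@qtgt sgQ x)) //; last exact: path_sorted nl.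
congr cons.
apply: sg_arrow_eqP; rewrite ?mid_alow ?src_alow ?tgt_alow //.
  by rewrite /= src_x; case: c low_v => //= ->.
by case: (rflag x l false) tgt_x => //= ->.
Qed.

(** * The order on arrows *)

Definition plus v : nat := (val v).2 == Some true.

(** The number of endpoints of the form [i^+] is the main key; the rank breaks ties and makes the
    code injective. *)
Definition sg_code x : nat :=
  ((plus (@qsrc sgQ x) + plus (@qtgt sgQ x)) * #|sgA| + enum_rank x)%N.

Lemma sg_code_inj : injective sg_code.
Proof.
move=> x y /(congr1 (modn^~ #|sgA|)); rewrite /sg_code !modnMDl.
rewrite !modn_small ?ltn_ord // => exy.
exact/enum_rank_inj/val_inj.
Qed.

Lemma plus_lower_if c v :
  lower_if c v = v \/ (plus (lower_if c v) < plus v)%N.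
Proof.
case: c; rewrite /lower_if; last by left.
have [pv|/lower_id ->] := eqVneq (val v).2 (Some true); last by left.
by right; rewrite /plus val_lower pv.
Qed.

(** Either the arrow is unchanged or its main key drops, and a drop by one outweighs any rank, as
    ranks are below [#|sgA|]. *)
Lemma sg_code_alow c d x : (sg_code (alow c d x) <= sg_code x)%N.
Proof.
have [es|lts] := plus_lower_if c (@qsrc sgQ x);
have [et|ltt] := plus_lower_if d (@qtgt sgQ x).
  suff -> : alow c d x = x by [].
  by apply: sg_arrow_eqP; rewrite ?mid_alow ?src_alow ?tgt_alow.
all: rewrite /sg_code src_alow tgt_alow; apply: leq_trans (leq_addr _ _).
all: apply: (@leq_trans (_ + #|sgA|)%N);
  first exact: leq_add (leqnn _) (ltnW (ltn_ord _)).
all: rewrite addnC -mulSn leq_mul2r ?es ?et; apply/orP; right.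
- by rewrite -addnS leq_add2l.
- by rewrite -addSn leq_add2r.
- by rewrite -addnS leq_add // ltnW.
Qed.

Definition sg_le := @code_le sgQ sg_code.

Lemma nf_le p : sg_le (nf p) p.
Proof.
apply: digits_le; rewrite parr_nf.
move: (parr p) => l; suff gen c :
  all2 (fun x y => sg_code x <= sg_code y)%N (alows c false l) l by exact: gen.
by elim: l c => //= x l IH c; rewrite IH andbT sg_code_alow.
Qed.

(** * Paths of length two *)

Lemma parr_eqP p q : psrc p = psrc q -> map val (parr p) = map val (parr q) ->
  p = q.
Proof. by move=> es /(inj_map val_inj) ea; apply: qpath_eqP. Qed.

(** Made total by defaults so that it can stand under a sum over [j]; [path2E] shows that none is
    used when the vertices lie over the ends of the arrows. *)
Definition path2 (i : sgV) (a : qA Q) (j : sgV) (a' : qA Q) (k : sgV) :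
    qpath sgQ :=
  insubd (@ptriv sgQ i) (i, pmap insub [:: (i, a, j); (j, a', k)]).

Section Path2.
Variables (i : sgV) (a : qA Q) (j : sgV) (a' : qA Q) (k : sgV).
Hypotheses (ia : sg_base i = qsrc a) (aj : sg_base j = qtgt a).
Hypotheses (ja : sg_base j = qsrc a') (ak : sg_base k = qtgt a').

Lemma path2E : exists x y : sgA, [/\ val x = (i, a, j), val y = (j, a', k)
  & pval (path2 i a j a' k) = (i, [:: x; y])].
Proof.
have Px : (sg_base i == qsrc a) && (sg_base j == qtgt a) by rewrite ia aj !eqxx.
have Py : (sg_base j == qsrc a') && (sg_base k == qtgt a').
  by rewrite ja ak !eqxx.
exists (Sub (i, a, j) Px), (Sub (j, a', k) Py); split => //.
rewrite /path2 /= !insubT /=; rewrite val_insubd /=.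
by rewrite !eqxx.
Qed.

Lemma psrc_path2 : psrc (path2 i a j a' k) = i.
Proof. by have [x [y [_ _]]] := path2E; rewrite /psrc => ->. Qed.

Lemma ptgt_path2 : ptgt (path2 i a j a' k) = k.
Proof.
have [x [y [_ ey]]] := path2E.
by rewrite /ptgt /psrc /parr => -> /=; rewrite ey.
Qed.

Lemma map_val_path2 :
  map val (parr (path2 i a j a' k)) = [:: (i, a, j); (j, a', k)].
Proof.
by have [x [y [ex ey]]] := path2E; rewrite /parr => -> /=; rewrite ex ey.
Qed.

Lemma alive_path2 :
  alive (parr (path2 i a j a' k)) = (r a a' ==> (qtgt a \in special b)).
Proof.
have [x [y [ex ey]]] := path2E; rewrite /parr => -> /=.
by rewrite /alive /= /mid ex ey andbT.
Qed.

Lemma map_val_nf_path2 : r a a' ->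
  map val (parr (nf (path2 i a j a' k))) =
    [:: (i, a, lower j); (lower j, a', k)].
Proof.
have [x [y [ex ey]]] := path2E; rewrite parr_nf /parr => -> raa' /=.
have [sx mx tx] : [/\ @qsrc sgQ x = i, mid x = a & @qtgt sgQ x = j].
  by rewrite /mid /= ex.
have [sy my ty] : [/\ @qsrc sgQ y = j, mid y = a' & @qtgt sgQ y = k].
  by rewrite /mid /= ey.
by rewrite !val_alow sx mx tx sy my ty raa'.
Qed.

Lemma pmul_sg_arr (K : fieldType) :
  pmul (sg_arr K i a j) (sg_arr K j a' k) = << path2 i a j a' k >>.
Proof.
have [x [y [ex ey pE]]] := path2E.
rewrite /sg_arr -ex -ey !valK pmulUU; apply: path_mul_cat.
- by rewrite psrc_path2 /psrc /= ex.
- by rewrite /ptgt /psrc /= ex ey.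
- by rewrite /parr pE.
Qed.

End Path2.

(** * The normal form map on the path algebra and its kernel *)

Section Ideal.
Variable K : fieldType.
Hypothesis r_comp : forall a a' : qA Q, r a a' -> qtgt a = qsrc a'.

Definition nf_val p : palg K sgQ := if alive (parr p) then << nf p >> else 0.

(** Being alive is invariant under lowering, so the value depends only on the lowered concatenation
    and the source. *)
Lemma nf_val_cat p q p' q' s s' :
    alows false false (parr p ++ parr q) =
      alows false false (parr p' ++ parr q') ->
    psrc s = psrc p -> parr s = parr p ++ parr q ->
    psrc s' = psrc p' -> parr s' = parr p' ++ parr q' -> psrc p = psrc p' ->
  nf_val s = nf_val s'.
Proof.
move=> e es ea es' ea' ep.
have enf : nf s = nf s'.
  by apply: qpath_eqP; rewrite ?psrc_nf ?parr_nf ?es ?es' ?ea ?ea'.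
by rewrite /nf_val -alive_alows -[alive (parr s')]alive_alows -!parr_nf enf.
Qed.

(** [nf q] starts where [q] does, so composability is unaffected; if [q] is not alive, neither is
    the product, and both sides vanish. *)
Lemma nf_val_catr p q :
  lext nf_val (lext (path_mul K p) (nf_val q)) = lext nf_val (path_mul K p q).
Proof.
rewrite {2}/nf_val /path_mul; case: pcatP => [s e es ea|ne]; last first.
  rewrite linear0; case: ifP => _; last by rewrite !linear0.
  by rewrite lextU; case: pcatP => // _; rewrite linear0.
rewrite lextU; case: ifP => [_|qN]; last first.
  rewrite !linear0 /nf_val ea; case: ifP => // /alive_catr.
  by rewrite qN.
rewrite lextU; case: pcatP => [s' _ es' ea'|]; last by rewrite psrc_nf.
rewrite lextU; apply: nf_val_cat es' ea' es ea _ => //.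
by rewrite parr_nf alows_catr.
Qed.

Lemma nf_val_catl p q :
  lext nf_val (lext (fun p' => path_mul K p' q) (nf_val p)) =
    lext nf_val (path_mul K p q).
Proof.
rewrite {2}/nf_val /path_mul; case: pcatP => [s e es ea|ne]; last first.
  rewrite linear0; case: ifP => _; last by rewrite !linear0.
  by rewrite lextU; case: pcatP => [s|_]; rewrite ?ptgt_nf ?linear0.
rewrite lextU; case: ifP => [_|pN]; last first.
  rewrite !linear0 /nf_val ea; case: ifP => // /alive_catl.
  by rewrite pN.
rewrite lextU; case: pcatP => [s' _ es' ea'|]; last by rewrite ptgt_nf.
rewrite lextU; apply: nf_val_cat es' ea' es ea _ => //.
by rewrite parr_nf alows_catl.
Qed.

Lemma nf_val_pmul (z w : palg K sgQ) : lext nf_val (pmul z w) =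
  lext (fun p => lext (fun q => lext nf_val (path_mul K p q)) w) z.
Proof.
rewrite pmulE; apply: etrans (lext_lext _ _ _) _.
by apply: eq_lext => p; apply: lext_lext.
Qed.

(** The case of paths extends by bilinearity. Hence the kernel of [lext nf_val] is closed under left
    multiplication; [nf_val_mull] gives the other side. *)
Lemma nf_val_mulr (z w : palg K sgQ) :
  lext nf_val (pmul z (lext nf_val w)) = lext nf_val (pmul z w).
Proof.
apply: etrans (nf_val_pmul _ _) (etrans _ (esym (nf_val_pmul _ _))).
apply: eq_lext => p; apply: etrans (lext_lext _ _ _) _; apply: eq_lext => q.
exact: etrans (esym (lext_lext _ _ _)) (nf_val_catr p q).
Qed.

Lemma nf_val_mull (z w : palg K sgQ) :
  lext nf_val (pmul (lext nf_val z) w) = lext nf_val (pmul z w).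
Proof.
apply: etrans (nf_val_pmul _ _) (etrans _ (esym (nf_val_pmul _ _))).
apply: etrans (lext_lext _ _ _) _; apply: eq_lext => p.
(* Exchanging the sums fixes the right factor [q], as [nf_val_catl] requires. *)
apply: etrans (lext_exchange _ _ _) _; apply: eq_lext => q.
exact: etrans (esym (lext_lext _ _ _)) (nf_val_catl p q).
Qed.

Lemma sum_sg_sign (i : qV Q) : i \in special b ->
  \sum_(j : sgV | sg_base j == i) sg_sign K j = 0.
Proof.
move=> si; have P o : isSome (Some o : option bool) == (i \in special b).
  by rewrite si.
pose vt o : sgV := Sub (i, Some o) (P o).
rewrite (bigD1 (vt true)) /=; last by rewrite /sg_base /=.
rewrite (bigD1 (vt false)) /=;
  last by rewrite /sg_base /= eqxx -val_eqE /= xpair_eqE andbF.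
rewrite big1 ?addr0 /sg_sign /= ?subrr //.
move=> j /andP[/andP[/eqP ji jt] jf].
have := sg_base_special j; rewrite ji si.
case ej: (val j).2 => [o|] // _.
suff jo: j = vt o by case: o jo jt jf {ej} => ->; rewrite eqxx.
by apply: val_inj; rewrite /= -ej -ji /sg_base -surjective_pairing.
Qed.

Lemma sg_relationE i a a' k : r a a' ->
    sg_base i = qsrc a -> sg_base k = qtgt a' ->
  sg_relation K i a a' k =
    \sum_(j : sgV | sg_base j == qsrc a') sg_sign K j *: << path2 i a j a' k >>.
Proof.
move=> raa ia ka; apply: eq_bigr => j /eqP ja.
by rewrite pmul_sg_arr // (r_comp raa).
Qed.

(** Over a non-special middle vertex no path is alive. Over a special one both paths have the same
    normal form, and their signs cancel. *)
Lemma nf_val_relation i a a' k : r a a' ->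
    sg_base i = qsrc a -> sg_base k = qtgt a' ->
  lext nf_val (sg_relation K i a a' k) = 0.
Proof.
move=> raa ia ka; rewrite sg_relationE // linear_sum /=.
have aliveE j : sg_base j == qsrc a' ->
    alive (parr (path2 i a j a' k)) = (qtgt a \in special b).
  by move/eqP => ja; rewrite alive_path2 ?raa // (r_comp raa).
have [sa|nsa] := boolP (qtgt a \in special b); last first.
  apply: big1 => j ja; rewrite lextZU /nf_val aliveE //.
  by rewrite (negPf nsa) scaler0.
have [j0 /eqP j0a | no_j] := pickP (fun j : sgV => sg_base j == qsrc a');
  last first.
  by apply: big1 => j; rewrite no_j.
(* The right-hand 0 becomes the sum of the signs times the common value, taken at [j0]. *)
rewrite -[RHS](scale0r (nf_val (path2 i a j0 a' k))).
rewrite -(sum_sg_sign sa) (r_comp raa).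
apply: etrans _ (esym (scaler_suml _ _ _ _)).
apply: eq_bigr => j ja; rewrite lextZU.
have low : lower j = lower j0.
  have eb : (val j).1 = (val j0).1 := etrans (eqP ja) (esym j0a).
  apply: val_inj; rewrite !val_lower eb.
  have := sg_base_special j; have := sg_base_special j0.
  rewrite (eqP ja) j0a -(r_comp raa) sa.
  by case: (val j).2 => [?|]; case: (val j0).2 => [?|].
have ja' := eqP ja; have rc := r_comp raa.
suff e : nf (path2 i a j a' k) = nf (path2 i a j0 a' k).
  by rewrite /nf_val (aliveE _ ja) (aliveE _ (introT eqP j0a)) e.
apply: parr_eqP; first by rewrite !psrc_nf !psrc_path2 ?rc.
by rewrite !map_val_nf_path2 ?rc // low.
Qed.

Lemma sg_ideal_nf_val (I : palg K Q -> Prop) :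
    (forall a a', path2_in I a a' -> r a a') ->
  forall z, sg_ideal I b z -> lext nf_val z = 0.
Proof.
move=> rI z; elim=> [|w|w1 w2 _ IH1 _ IH2|w1 w2 _ IH|w1 w2 _ IH].
- exact: linear0.
- move=> [i [a [a' [k [/rI raa ia ka ->]]]]]; exact: nf_val_relation.
- by rewrite linearD /= IH1 IH2 addr0.
- by rewrite -nf_val_mulr IH pmulx0 linear0.
- by rewrite -nf_val_mull IH pmul0x linear0.
Qed.

(** * Tips of elements of the kernel and of relations *)

Lemma tip_not_normal z p : lext nf_val z = 0 -> is_tip sg_le z p ->
  ~~ normal (parr p).
Proof.
move=> /(congr1 (mcoeff p)) + [zp le_p]; apply: contraPN => np.
have nfp : nf p = p.
  apply: qpath_eqP => //; exact: normal_alows (pvalP p) np.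
(* The coefficient of [p] in the image is that of [p] in [z], which is nonzero, plus contributions
   of the other [q], shown to vanish. *)
rewrite /lext raddf_sum (big_fsetD1 p) //= big1_fset => [|q].
  rewrite mcoeffZ /nf_val normal_alive // nfp mcoeffUU mulr1 addr0 mcoeff0.
  by apply/eqP; rewrite mcoeff_neq0.
rewrite in_fsetD1 => /andP[neq_qp zq] _.
rewrite mcoeffZ /nf_val; case: ifP => _; last by rewrite mcoeff0 mulr0.
rewrite mcoeffU; case: eqP => [eq|]; last by rewrite mulr0.
case/eqP: neq_qp; apply: (@path_code_inj sgQ _ sg_code_inj).
(* The tip property puts [q] below [p], and [nf q = p] puts [p] below [q]. *)
apply: anti_leq; apply/andP; split; first exact: le_p.
by have := nf_le q; rewrite eq.
Qed.

(** As the middle vertex is not of the form [i^-], any other path of the relation is the normal form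
    of this one, hence smaller. *)
Lemma relation_tip x y : r (mid x) (mid y) ->
    @qtgt sgQ x = @qsrc sgQ y -> (val (@qtgt sgQ x)).2 != Some false ->
  exists p, [/\ psrc p = @qsrc sgQ x, parr p = [:: x; y] &
    is_tip sg_le (sg_relation K (@qsrc sgQ x) (mid x) (mid y) (@qtgt sgQ y)) p].
Proof.
move=> rxy exy not_minus; set i := @qsrc sgQ x; set k := @qtgt sgQ y.
set a := mid x; set a' := mid y; set j0 := @qtgt sgQ x in exy not_minus *.
have ia : sg_base i = qsrc a := base_src x.
have ka : sg_base k = qtgt a' := base_tgt y.
have j0a : sg_base j0 = qsrc a' by rewrite exy base_src.
have ta := r_comp rxy.
have psrcE j : sg_base j = qsrc a' -> psrc (path2 i a j a' k) = i.
  by move=> ja; rewrite psrc_path2 // ta.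
have arrE j : sg_base j = qsrc a' ->
    map val (parr (path2 i a j a' k)) = [:: (i, a, j); (j, a', k)].
  by move=> ja; rewrite map_val_path2 // ta.
exists (path2 i a j0 a' k); split; first exact: psrcE.
  apply: (inj_map val_inj); rewrite arrE //= {2}exy /i /k /a /a' /j0 /mid /=.
  by rewrite -!surjective_pairing.
have suppE q : q \in msupp (sg_relation K i a a' k) ->
    exists2 j, sg_base j = qsrc a' & q = path2 i a j a' k.
  rewrite sg_relationE // -mcoeff_neq0 raddf_sum /=.
  have [j /andP[/eqP ja /eqP ->] _|no_j] :=
    pickP (fun j : sgV => (sg_base j == qsrc a') && (q == path2 i a j a' k)).
    by exists j.
  rewrite big1 ?eqxx // => j ja; rewrite mcoeffZ mcoeffU.
  by have := no_j j; rewrite ja eq_sym /= => ->; rewrite mulr0.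
split.
  rewrite -mcoeff_neq0 sg_relationE // raddf_sum /= (bigD1 j0) ?j0a //=.
  rewrite big1 => [|j /andP[/eqP ja neq_j]].
    rewrite addr0 mcoeffZ mcoeffUU mulr1 /sg_sign; case: ifP => _.
      by rewrite oppr_eq0 oner_eq0.
    exact: oner_neq0.
  rewrite mcoeffZ mcoeffU; case: eqP => [ep|]; last by rewrite mulr0.
  (* Distinct middle vertices give distinct paths, so the coefficient of the chosen path is its
     sign. *)
  have := arrE j ja; rewrite ep arrE // => -[ej _].
  by rewrite ej eqxx in neq_j.
move=> q /suppE[j ja ->].
have eb : (val j).1 = (val j0).1 := etrans ja (esym j0a).
have jE : j = j0 \/ j = lower j0.
  have sj := sg_base_special j; have sj0 := sg_base_special j0.
  have ej2 : isSome (val j).2 = isSome (val j0).2 by rewrite sj sj0 ja j0a.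
  have eqv (v v' : sgV) :
      (val v).1 = (val v').1 -> (val v).2 = (val v').2 -> v = v'.
    move=> e1 e2; apply: val_inj.
    by rewrite [LHS]surjective_pairing [RHS]surjective_pairing e1 e2.
  have [e2|ne2] := eqVneq (val j).2 (val j0).2; first by left; exact: eqv.
  right; apply: eqv; rewrite val_lower //=.
  move: ej2 ne2 not_minus.
  by case: (val j).2 => [[]|]; case: (val j0).2 => [[]|].
case: jE => [->|jE]; first exact: leqnn.
suff -> : path2 i a j a' k = nf (path2 i a j0 a' k) by exact: nf_le.
apply: parr_eqP; first by rewrite psrc_nf !psrcE.
by rewrite arrE // map_val_nf_path2 ?ta // jE.
Qed.

Lemma not_normalP l : ~~ normal l ->
  exists l1 x y l2, [/\ l = l1 ++ [:: x, y & l2], r (mid x) (mid y) &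
    (val (@qtgt sgQ x)).2 != Some false].
Proof.
elim: l => [//|x [//|y l] IH] /=; rewrite negb_and negb_imply.
case/orP => [/andP[rxy tx]|/IH]; first by exists [::], x, y, l.
by move=> [l1 [x' [y' [l2 [-> rxy tx]]]]]; exists (x :: l1), x', y', l2.
Qed.

End Ideal.

End Lowering.

(** * The quadratic Gröbner basis *)

Section Groebner.
Variables (K : fieldType) (Q : quiver) (S : finType).
Variables (I : palg K Q -> Prop) (b : S -> qV Q).

(** Membership in [I] is a proposition; classical logic turns it into the boolean relation used
    above. *)
Let r : rel (qA Q) := fun a a' => `[< path2_in I a a' >].

Let rP a a' : r a a' -> path2_in I a a'.
Proof. by move/asboolP. Qed.

Let r_comp a a' : r a a' -> qtgt a = qsrc a'.
Proof. by case/rP. Qed.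

Definition sg_relations (z : palg K (sg_quiver b)) : Prop :=
  exists i a a' k, [/\ path2_in I a a', sg_base i = qsrc a,
    sg_base k = qtgt a' & z = sg_relation K i a a' k].

(** Yields both the uniformity and the quadraticity of the relations. *)
Lemma sg_relations_supp z : sg_relations z -> exists i k,
  forall p, p \in msupp z -> [/\ psrc p = i, ptgt p = k & plen p = 2].
Proof.
move=> [i [a [a' [k [Iaa ia ka ->]]]]]; exists i, k => p.
rewrite (sg_relationE K r_comp) //; last exact/asboolP.
rewrite -mcoeff_neq0 raddf_sum /= => nz.
have [j /andP[/eqP ja /eqP ->]|no_j] := pickP (fun j : sg_vertex b =>
    (sg_base j == qsrc a') && (p == path2 i a j a' k)); last first.
  case/eqP: nz; apply: big1 => j ja; rewrite mcoeffZ mcoeffU.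
  by have := no_j j; rewrite ja eq_sym /= => ->; rewrite mulr0.
have aj : sg_base j = qtgt a by rewrite ja -(r_comp (introT (asboolP _) Iaa)).
rewrite psrc_path2 ?ptgt_path2 //; split => //.
by rewrite /plen -(size_map val) map_val_path2.
Qed.

Lemma sg_ideal_strong_koszul : strong_koszul (sg_ideal I b).
Proof.
have quad z : sg_relations z -> quadratic_elt z.
  by move=> /sg_relations_supp[i [k supp]] p /supp[].
split; first by exists sg_relations.
exists (@sg_le Q S b); split; first exact/code_admissible/sg_code_inj.
exists sg_relations => //; split.
- by move=> g; apply: ideal_gen_in.
- move=> g /sg_relations_supp[i [k supp]] p q.
  by move=> /supp[-> -> _] /supp[-> -> _].
(* First inclusion: the tip of an element of the ideal is not normal, so two consecutive arrows of
   it form the tip of a relation. *)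
- move=> z; split; apply: ideal_gen_sub => {}z [p [g [Ig g_neq0 tip_p]] ->].
    have g_nf : lext (nf_val r K) g = 0.
      by apply: sg_ideal_nf_val Ig => // a a' Iaa; apply/asboolP.
    have [l1 [x [y [l2 [ep rxy tx]]]]] :=
      not_normalP (tip_not_normal g_nf tip_p).
    have := pvalP p; rewrite -/(parr p) -/(psrc p) ep walk_cat.
    move=> /andP[_ /= /and3P[sx sy _]].
    have exy : @qtgt (sg_quiver b) x = @qsrc (sg_quiver b) y by apply/esym/eqP.
    have [t [st at_ tip_t]] := relation_tip K r_comp rxy exy tx.
    apply: (ideal_gen_factor (t := t) (l1 := l1) (l2 := l2)).
    + by rewrite ep at_.
    + by rewrite st; apply/esym/eqP.
    apply: ideal_gen_in; exists t => //.
    eexists; split; last exact: tip_t; last first.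
      (* The relation is nonzero because its tip lies in its support. *)
      by apply: contraTneq (proj1 tip_t) => ->; rewrite msupp0 inE.
    by do 4!eexists; split;
      [exact: rP rxy | exact: base_src | exact: base_tgt | ].
  (* Converse inclusion: the relations lie in the ideal, so their tips are tips of the ideal. *)
  apply: ideal_gen_in; exists p => //; exists g; split => //.
  exact: ideal_gen_in.
Qed.

End Groebner.

Theorem proposition4p6 (K : closedFieldType) (hK : 2%N \notin [pchar K])
  (A : kalgebra K) (Q : quiver) (S : finType)
  (I : palg K Q -> Prop) (b : S -> qV Q)
  (hA : is_locally_skew_gentle I b A) :
  strong_koszul (sg_ideal I b).
Proof. exact: sg_ideal_strong_koszul. Qed.
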